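(* Let $G$ be a connected graph of order $n$ without isolated vertices. Then $\chi_d^t(G)\leq n+1-\alpha_0(G)$.
   Context: All graphs are finite, simple and undirected. A total dominator coloring of a graph $G$ is a proper vertex coloring of $G$ in which each vertex of $G$ is adjacent to every vertex of some color class (a color class is the set of all vertices receiving a given color). The total dominator chromatic number $\chi_d^t(G)$ is the minimum number of color classes in a total dominator coloring of $G$. For a graph $G=(V,E)$, consider independent vertex sets $S\subseteq V$ such that the induced subgraph $G[V-S]$ has no isolated vertex, or every isolated vertex of $G[V-S]$ is adjacent to all vertices of $S$; $\alpha_0(G)$ denotes the maximum cardinality of such a set $S$. *)

(* Defs.v *)
From mathcomp Require Import all_boot.
Set Implicit Arguments.
Unset Strict Implicit.
Unset Printing Implicit Defensive.

(* A graph is a finType T of vertices with an adjacency relation e : rel T,   *)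
(* assumed symmetric and irreflexive where it matters.                        *)

Section TotalDominatorColoring.

Variables (T : finType) (e : rel T).

Definition connected_graph : bool :=
  (0 < #|T|) && [forall x, forall y, connect e x y].

Definition independent (S : {set T}) : bool :=
  [forall x in S, forall y in S, ~~ e x y].

(* v is an isolated vertex of the induced subgraph G[W] *)
Definition isolated_in (W : {set T}) (v : T) : bool :=
  (v \in W) && [forall u in W, ~~ e v u].

Definition no_isolated_in (W : {set T}) : bool :=
  [forall v, ~~ isolated_in W v].

Section Coloring.

Variables (C : eqType) (c : T -> C).

Definition proper_coloring : bool := [forall x, forall y, e x y ==> (c x != c y)].

(* The classes of the colors that are used; in particular they are nonempty. *)
Definition color_classes : {set {set T}} := preim_partition c [set: T].

Definition td_coloring : bool :=
  proper_coloring &&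
  [forall v, exists A in color_classes, forall u in A, e v u].

End Coloring.

(* #|T| colors suffice for any coloring, see [td_chromatic_le]. The default   *)
(* value #|T| never beats a coloring, and the minimum is attained as soon as  *)
(* the graph has no isolated vertex, see [td_chromatic_attained].             *)
Definition td_chromatic : nat :=
  \big[minn/#|T|]_(c : {ffun T -> 'I_#|T|} | td_coloring c) #|color_classes c|.

Definition alpha0_admissible (S : {set T}) : bool :=
  independent S &&
  (no_isolated_in (~: S) ||
   [forall v, isolated_in (~: S) v ==> [forall u in S, e v u]]).

Definition alpha0 : nat := \max_(S : {set T} | alpha0_admissible S) #|S|.

Lemma color_classesP (C : eqType) (c : T -> C) (A : {set T}) :
  reflect (exists x, A = [set y | c y == c x]) (A \in color_classes c).
Proof.
apply: (iffP imsetP) => [[x _ ->]|[x ->]]; exists x => //;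
  by apply/setP=> y; rewrite !inE eq_sym.
Qed.

Lemma bigminn_le (I : eqType) (r : seq I) (P : pred I) (F : I -> nat) d i :
  i \in r -> P i -> \big[minn/d]_(j <- r | P j) F j <= F i.
Proof.
elim: r => // j r IH; rewrite inE big_cons => /orP[/eqP<- Pi|ir Pi].
  by rewrite Pi geq_minl.
have le := IH ir Pi; case: ifP => // _; exact: leq_trans (geq_minr _ _) le.
Qed.

Lemma bigminn_attained (I : eqType) (r : seq I) (P : pred I) (F : I -> nat) d :
  \big[minn/d]_(j <- r | P j) F j = d \/
  exists2 i, P i & \big[minn/d]_(j <- r | P j) F j = F i.
Proof.
elim: r => [|j r IH]; first by left; rewrite big_nil.
rewrite big_cons; case: ifP => // Pj.
case: (leqP (F j) (\big[minn/d]_(j <- r | P j) F j)) => [le|lt].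
  by right; exists j.
exact: IH.
Qed.

Lemma td_coloring_classes (C D : eqType) (c : T -> C) (d : T -> D) :
  (forall x y, (c x == c y) = (d x == d y)) ->
  color_classes c = color_classes d /\ td_coloring c = td_coloring d.
Proof.
move=> cd.
have eqcl : color_classes c = color_classes d.
  apply/setP=> A; apply/color_classesP/color_classesP => -[x ->]; exists x;
    by apply/setP=> y; rewrite !inE cd.
split=> //; rewrite /td_coloring eqcl; congr (_ && _).
by apply: eq_forallb => x; apply: eq_forallb => y; rewrite cd.
Qed.

Lemma td_chromatic_le (C : eqType) (c : T -> C) :
  td_coloring c -> td_chromatic <= #|color_classes c|.
Proof.
move=> tdc.
pose f x : T := odflt x [pick y | c y == c x].
have cf x : c (f x) = c x.
  by rewrite /f; case: pickP => [y /eqP //|].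
pose d : {ffun T -> 'I_#|T|} := [ffun x => enum_rank (f x)].
have cd x y : (c x == c y) = (d x == d y).
  rewrite !ffunE (inj_eq enum_rank_inj); apply/eqP/eqP => [cxy|fxy].
    rewrite /f (eq_pick (_ : (fun z => c z == c x) =1 (fun z => c z == c y))).
      by case: pickP => // /(_ y); rewrite eqxx.
    by move=> z /=; rewrite cxy.
  by rewrite -(cf x) -(cf y) fxy.
have [-> tdE] := td_coloring_classes cd.
apply: (@bigminn_le _ _ _ (fun c : {ffun T -> 'I_#|T|} => #|color_classes c|)).
  exact: mem_index_enum.
by rewrite -tdE.
Qed.

Lemma td_chromatic_attained :
  irreflexive e -> no_isolated_in [set: T] ->
  exists2 c : {ffun T -> 'I_#|T|},
    td_coloring c & td_chromatic = #|color_classes c|.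
Proof.
move=> irr noiso.
pose c0 : {ffun T -> 'I_#|T|} := [ffun x => enum_rank x].
have c0E x y : (c0 x == c0 y) = (x == y).
  by rewrite !ffunE (inj_eq enum_rank_inj).
have td0 : td_coloring c0.
  apply/andP; split.
    apply/'forall_forallP => x y; rewrite c0E; apply/implyP.
    by apply: contraTneq => ->; rewrite irr.
  apply/forallP=> v; move/forallP/(_ v): noiso.
  rewrite /isolated_in inE /= negb_forall => /existsP[u].
  rewrite inE /= negbK => evu.
  apply/existsP; exists [set u]; apply/andP; split.
    by apply/color_classesP; exists u; apply/setP=> y; rewrite !inE c0E.
  by apply/forallP=> w; rewrite inE; apply/implyP=> /eqP->.
have card0 : #|color_classes c0| = #|T|.
  rewrite -[RHS]cardsT /color_classes /preim_partition /equivalence_partition.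
  apply: card_in_imset => x y _ _ /setP/(_ x).
  by rewrite !inE eqxx c0E => /esym/eqP->.
have [E|[c tdc E]] := bigminn_attained (index_enum _)
  (fun c : {ffun T -> 'I_#|T|} => td_coloring c)
  (fun c : {ffun T -> 'I_#|T|} => #|color_classes c|) #|T|.
  by exists c0 => //; rewrite card0.
by exists c.
Qed.

End TotalDominatorColoring.

(* Main.v *)
Require Import Defs.
From mathcomp Require Import all_boot.
Set Implicit Arguments.
Unset Strict Implicit.
Unset Printing Implicit Defensive.

(* Given an admissible set S, color S with a single color and give every      *)
(* vertex outside S a color of its own. A vertex having a neighbor u outside  *)
(* S dominates the class {u}; by independence of S every other vertex is      *)
(* isolated in G[V - S], hence dominates the class S.                         *)

(** Applied to a largest admissible [S], this one coloring gives the bound: its classes are [S] and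
    at most [n - #|S|] singletons ([card_merge_coloring]). For domination ([td_merge_coloring]), the
    critical vertices are those with all neighbors in [S]: the first alternative of admissibility
    rules them out, the second makes them adjacent to all of [S]. *)

Definition merge_coloring (T : finType) (S : {set T}) (x : T) : option T :=
  if x \in S then None else Some x.

Lemma merge_coloring_class_in (T : finType) (S : {set T}) (x : T) :
  x \in S -> [set y | merge_coloring S y == merge_coloring S x] = S.
Proof.
by move=> xS; apply/setP=> y; rewrite inE /merge_coloring xS; case: ifP.
Qed.

Lemma merge_coloring_class_notin (T : finType) (S : {set T}) (x : T) :
  x \notin S -> [set y | merge_coloring S y == merge_coloring S x] = [set x].
Proof.
move=> xS; apply/setP=> y; rewrite !inE /merge_coloring (negPf xS).
by case: ifPn => // yS; apply/esym/eqP=> yx; rewrite yx (negPf xS) in yS.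
Qed.

(** Only an inequality: for empty [S] there is no class [S], and the count is one less. *)
Lemma card_merge_coloring (T : finType) (S : {set T}) :
  #|color_classes (merge_coloring S)| <= #|T| + 1 - #|S|.
Proof.
have sub : color_classes (merge_coloring S) \subset S |: (set1 @: ~: S).
  apply/subsetP=> A /color_classesP[x ->]; rewrite in_setU1.
  have [xS|xS] := boolP (x \in S); first by rewrite merge_coloring_class_in ?eqxx.
  by rewrite merge_coloring_class_notin // imset_f ?orbT // inE.
apply: leq_trans (subset_leq_card sub) _.
rewrite cardsU1 -(cardsC S) -addnA addKn addnC leq_add ?leq_imset_card //.
exact: leq_b1.
Qed.

Lemma td_merge_coloring (T : finType) (e : rel T) (S : {set T}) :
  irreflexive e -> no_isolated_in e [set: T] -> alpha0_admissible e S ->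
  td_coloring e (merge_coloring S).
Proof.
move=> irr noiso /andP[indS admS].
have nadjS x y : x \in S -> y \in S -> ~~ e x y.
  by move=> xS yS; move/forall_inP: indS => /(_ x xS)/forall_inP; apply.
have nbr v : exists u, e v u.
  move/forallP/(_ v): noiso; rewrite /isolated_in inE negb_forall.
  by case/existsP=> u; rewrite inE negbK => evu; exists u.
apply/andP; split.
  apply/'forall_forallP => x y; apply/implyP=> exy; rewrite /merge_coloring.
  case: ifPn => xS; case: ifPn => yS //; first by rewrite (negPf (nadjS x y _ _)) in exy.
  by apply: contraTneq exy => -[->]; rewrite irr.
apply/forallP=> v.
have [/existsP[u /andP[uS evu]]|noout] := boolP [exists u, (u \notin S) && e v u].
  apply/existsP; exists [set u]; apply/andP; split.
    by apply/color_classesP; exists u; rewrite merge_coloring_class_notin.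
  by apply/forall_inP=> w; rewrite inE => /eqP->.
have nbrS u : e v u -> u \in S.
  by move=> evu; apply: contraR noout => uS; apply/existsP; exists u; rewrite uS.
(* The neighbor [u] in [S] serves twice: it forces [v] out of the independent set [S], and it shows
   that [S] is nonempty, hence a genuine color class. *)
have [u evu] := nbr v; have uS := nbrS u evu.
have vS : v \notin S by apply: contraL evu => vS; exact: nadjS.
have isov : isolated_in e (~: S) v.
  rewrite /isolated_in inE vS; apply/forall_inP=> w; rewrite inE.
  by apply: contra; exact: nbrS.
apply/existsP; exists S; apply/andP; split.
  by apply/color_classesP; exists u; rewrite merge_coloring_class_in.
case/orP: admS => [/forallP/(_ v)|/forallP/(_ v)]; first by rewrite isov.
by rewrite isov.
Qed.

(** The empty set is admissible, so the maximum ranges over a nonempty family and is not merely the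
    default 0. *)
Lemma alpha0_attained (T : finType) (e : rel T) :
  no_isolated_in e [set: T] ->
  exists2 S : {set T}, alpha0_admissible e S & alpha0 e = #|S|.
Proof.
move=> noiso; have adm0 : alpha0_admissible e set0.
  apply/andP; split; last by rewrite setC0 noiso.
  by apply/forall_inP=> x; rewrite inE.
have adm_gt0 : 0 < #|alpha0_admissible e| by apply/card_gt0P; exists set0.
have [S admS E] := eq_bigmax_cond (fun S : {set T} => #|S|) adm_gt0.
by exists S.
Qed.

Theorem theorem3p4 (T : finType) (e : rel T) (n : nat)
    (e_sym : symmetric e) (e_irr : irreflexive e)
    (order_n : #|T| = n)
    (G_connected : connected_graph e)
    (G_no_isolated : no_isolated_in e [set: T]) :
  td_chromatic e <= n + 1 - alpha0 e.
Proof.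
have [S admS ->] := alpha0_attained G_no_isolated; rewrite -order_n.
apply: leq_trans (card_merge_coloring S).
exact/td_chromatic_le/td_merge_coloring.
Qed.
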